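(* Let $\mathcal{F}=\{A_1,A_2,\ldots,A_m\}\subset\mathbb{C}^{n\times n}$ be any finite family of rank-one matrices. Then $$\rho(\mathcal{F})=\max_{1\le k\le m}\left(\max_{A\in\mathcal{F}^{( * )}_k}\rho(A)^{1/k}\right),$$ where $\mathcal{F}^{( * )}_k=\{A_{i_1}A_{i_2}\cdots A_{i_k}: 1\le i_1,\ldots,i_k\le m,\ i_s\neq i_t \text{ when } s\neq t\}$ is the set of all products of length $k$ of elements of $\mathcal{F}$ with distinct factors.
   Context: For a finite set $\mathcal{F}=\{A_1,\ldots,A_m\}$ of complex $n\times n$ matrices and $k\ge 1$, let $\mathcal{F}_k=\{A_{i_1}A_{i_2}\cdots A_{i_k}: 1\le i_j\le m\}$ be the set of all products of length $k$. The joint (equivalently, generalized) spectral radius of $\mathcal{F}$ is $\rho(\mathcal{F})=\lim_{k\to\infty}\max_{A\in\mathcal{F}_k}\|A\|^{1/k}=\limsup_{k\to\infty}\max_{A\in\mathcal{F}_k}\rho(A)^{1/k}$, where $\|\cdot\|$ is any sub-multiplicative matrix norm and $\rho(A)$ is the spectral radius of a matrix $A$ (the two expressions are known to coincide for finite sets). *)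

(* Defs.v *)
From HB Require Import structures.
From mathcomp Require Import all_boot all_order all_algebra.
From mathcomp Require Import all_classical all_reals all_analysis.
From mathcomp Require Export complex.

Set Implicit Arguments.
Unset Strict Implicit.
Unset Printing Implicit Defensive.

Import Order.TTheory GRing.Theory Num.Theory.
Import numFieldNormedType.Exports.

Local Open Scope classical_set_scope.
Local Open Scope ring_scope.
Local Open Scope complex_scope.

Section JointSpectralRadius.
Context {R : realType}.

(* [Normc.normc] is the modulus with values in [R]; the norm [`|z|] of
   the [numFieldType] structure on [R[i]] takes its values in [R[i]]. *)
Record submultiplicative_norm n (N : 'M[R[i]]_n -> R) : Prop := {
  submult_norm_eq0 : forall A, N A = 0 -> A = 0 ;
  submult_normZ : forall c A, N (c *: A) = Normc.normc c * N A ;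
  submult_normD : forall A B, N (A + B) <= N A + N B ;
  submult_normM : forall A B, N (A *m B) <= N A * N B }.

(* For [0 < n] the spectrum is finite and nonempty, so the supremum is a
   maximum. *)
Definition spectral_radius n (A : 'M[R[i]]_n) : R :=
  sup [set Normc.normc a | a in [set a : R[i] | eigenvalue A a]].

Definition word_prod m n (F : 'I_m -> 'M[R[i]]_n) (w : seq 'I_m) : 'M[R[i]]_n :=
  \big[mulmx/1%:M]_(i <- w) F i.

(* In the maxima below all the terms are nonnegative, so that the default value
   0 of the iterated maximum is harmless as soon as [0 < m].  The (irrelevant)
   terms of index [k = 0] of the sequences use [0^-1 = 0]. *)
Definition max_norm_root m n (N : 'M[R[i]]_n -> R) (F : 'I_m -> 'M[R[i]]_n)
    (k : nat) : R :=
  \big[Num.max/0]_(w : k.-tuple 'I_m) N (word_prod F w) `^ k%:R^-1.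

Definition max_spectral_root m n (F : 'I_m -> 'M[R[i]]_n) (k : nat) : R :=
  \big[Num.max/0]_(w : k.-tuple 'I_m)
    spectral_radius (word_prod F w) `^ k%:R^-1.

Definition joint_spectral_radius m n (N : 'M[R[i]]_n -> R)
    (F : 'I_m -> 'M[R[i]]_n) : R :=
  limn (max_norm_root N F).

(* The upper limit is taken in the extended reals, where it always exists. *)
Definition generalized_spectral_radius m n (F : 'I_m -> 'M[R[i]]_n) : \bar R :=
  limn_esup (fun k => (max_spectral_root F k)%:E).

Definition max_distinct_spectral_root m n (F : 'I_m -> 'M[R[i]]_n)
    (k : nat) : R :=
  \big[Num.max/0]_(w : k.-tuple 'I_m | uniq w)
    spectral_radius (word_prod F w) `^ k%:R^-1.

End JointSpectralRadius.

(* Main.v *)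
Require Import Defs.
From mathcomp Require Import all_boot all_order all_algebra.
From mathcomp Require Import zify.
From mathcomp Require Import all_classical all_reals all_analysis.
Import Order.TTheory GRing.Theory Num.Theory.
Import numFieldNormedType.Exports.
Local Open Scope classical_set_scope.
Local Open Scope ring_scope.
Local Open Scope complex_scope.

(* Write F i = u_i v_i with u_i a column and v_i a row, and let
   d i j = v_i u_j.  A product of the F i along a word i_1 ... i_k is the
   outer product of u_(i_1) and v_(i_k) scaled by the weight
   d i_1 i_2 * ... * d i_(k-1) i_k of a walk in the complete graph on the
   indices, and its spectral radius is the modulus of the weight of the closed
   walk i_1 ... i_k i_1.  A walk which visits a vertex twice contains a shorter
   closed walk; excising it repeatedly bounds the weight of every closed walk of
   length k by r^k, where r is the maximum over simple cycles, and the weight of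
   every open walk by a constant times s^k for each s > r.  Conversely, if r > 0
   it is attained by a simple cycle, and the prefixes of the periodic word that
   follows this cycle give products of norm at least a constant times r^k. *)

Set Implicit Arguments.
Unset Strict Implicit.
Unset Printing Implicit Defensive.

(** * Weights of walks *)

(** A walk is a start vertex with the list of later ones, as for [path]; it is closed when
    [last x p = x], and [rcons p x] closes it up. *)
Definition walk_weight (S : pzRingType) (T : Type) (c : T -> T -> S)
    (x : T) (p : seq T) : S :=
  \prod_(a <- pairmap c x p) a.

Lemma walk_weight_nil (S : pzRingType) (T : Type) (c : T -> T -> S) (x : T) :
  walk_weight c x [::] = 1.
Proof. by rewrite /walk_weight big_nil. Qed.

Lemma walk_weight_cons (S : pzRingType) (T : Type) (c : T -> T -> S)
    (x y : T) (p : seq T) :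
  walk_weight c x (y :: p) = c x y * walk_weight c y p.
Proof. by rewrite /walk_weight big_cons. Qed.

Lemma walk_weight_cat (S : pzRingType) (T : Type) (c : T -> T -> S)
    (x : T) (p q : seq T) :
  walk_weight c x (p ++ q) = walk_weight c x p * walk_weight c (last x p) q.
Proof. by rewrite /walk_weight pairmap_cat big_cat. Qed.

Lemma walk_weight_ge0 (S : numDomainType) (T : Type) (c : T -> T -> S)
    (c_ge0 : forall x y, 0 <= c x y) (x : T) (p : seq T) :
  0 <= walk_weight c x p.
Proof.
elim: p x => [|y p IHp] x; first by rewrite walk_weight_nil.
by rewrite walk_weight_cons mulr_ge0.
Qed.

Lemma walk_weight_le (S : numDomainType) (T : Type) (c : T -> T -> S) (b : S)
    (c_ge0 : forall x y, 0 <= c x y) (c_le : forall x y, c x y <= b)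
    (x : T) (p : seq T) :
  walk_weight c x p <= b ^+ size p.
Proof.
elim: p x => [|y p IHp] x; first by rewrite walk_weight_nil.
by rewrite walk_weight_cons exprS ler_pM // walk_weight_ge0.
Qed.

Lemma nuniq_split (T : eqType) (p : seq T) : ~~ uniq p ->
  exists p1 y p2 p3, p = p1 ++ (y :: p2) ++ (y :: p3).
Proof.
elim: p => //= x p IHp; rewrite negb_and negbK => /orP[|/IHp].
  by case/splitPr => p2 p3; exists [::], x, p2, p3.
by move=> [p1 [y [p2 [p3 ->]]]]; exists (x :: p1), y, p2, p3.
Qed.

(** Strong induction on the length. Without repetition in [p] the closed walk is empty or a simple
    cycle; otherwise cutting at a repeated vertex [y] yields two shorter closed walks whose weights
    multiply. *)
Lemma closed_walk_weight_le (S : numDomainType) (T : eqType) (c : T -> T -> S)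
    (r : S) (c_ge0 : forall x y, 0 <= c x y) (r_ge0 : 0 <= r)
    (cycle_le : forall x p,
       uniq (x :: p) -> walk_weight c x (rcons p x) <= r ^+ (size p).+1)
    (x : T) (p : seq T) :
  last x p = x -> walk_weight c x p <= r ^+ size p.
Proof.
have [k] := ubnP (size p); elim: k => // k IHk in x p *; rewrite ltnS => lepk.
have [up|] := boolP (uniq p).
  case/lastP: p => [|q y] in up lepk *; first by rewrite walk_weight_nil.
  rewrite last_rcons => yx; rewrite {}yx rcons_uniq in up *.
  by rewrite size_rcons cycle_le.
move=> /nuniq_split[p1 [y [p2 [p3 def_p]]]]; rewrite {}def_p in lepk *.
move: lepk; rewrite !size_cat /= => lepk.
rewrite !last_cat /= last_cat /= => lastx.
(* The walk goes to [y], makes the loop [rcons p2 y], and goes on along [p3]. *)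
have -> : p1 ++ (y :: p2) ++ y :: p3 = (rcons p1 y) ++ (rcons p2 y) ++ p3.
  by rewrite -!cats1 -!catA.
rewrite !walk_weight_cat !last_rcons mulrCA.
have -> : r ^+ (size p1 + ((size p2).+1 + (size p3).+1)) =
          r ^+ size (rcons p2 y) * r ^+ size (rcons p1 y ++ p3).
  by rewrite -exprD size_cat !size_rcons; congr (_ ^+ _); lia.
have := walk_weight_cat c x (rcons p1 y) p3; rewrite last_rcons => <-.
apply: ler_pM; rewrite ?walk_weight_ge0 //; apply: IHk.
- by rewrite size_rcons; lia.
- by rewrite last_rcons.
- by rewrite size_cat size_rcons; lia.
- by rewrite last_cat last_rcons.
Qed.

(** Loops are excised at the cost of a factor [r] per step. What remains has no repetition in its
    list, hence at most [#|T|] steps, and each of these loses at most a factor [C]; [1 <= C] makes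
    the bound uniform. *)
Lemma open_walk_weight_le (S : numDomainType) (T : finType) (c : T -> T -> S)
    (r C : S) (c_ge0 : forall x y, 0 <= c x y) (r_ge0 : 0 <= r) (C_ge1 : 1 <= C)
    (c_le : forall x y, c x y <= C * r)
    (closed_le : forall x p, last x p = x -> walk_weight c x p <= r ^+ size p)
    (x : T) (p : seq T) :
  walk_weight c x p <= C ^+ #|T| * r ^+ size p.
Proof.
have C_ge0 : 0 <= C by apply: le_trans C_ge1.
have [k] := ubnP (size p); elim: k => // k IHk in x p *; rewrite ltnS => lepk.
have [up|] := boolP (uniq p).
  apply: le_trans (walk_weight_le c_ge0 c_le x p) _.
  rewrite exprMn ler_wpM2r ?exprn_ge0 // ler_weXn2l //.
  by rewrite -(card_uniqP up) max_card.
move=> /nuniq_split[p1 [y [p2 [p3 def_p]]]]; rewrite {}def_p in lepk *.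
move: lepk; rewrite !size_cat /= => lepk.
have -> : p1 ++ (y :: p2) ++ y :: p3 = (rcons p1 y) ++ (rcons p2 y) ++ p3.
  by rewrite -!cats1 -!catA.
rewrite !walk_weight_cat !last_rcons mulrCA.
have -> : r ^+ (size p1 + ((size p2).+1 + (size p3).+1)) =
          r ^+ size (rcons p2 y) * r ^+ size (rcons p1 y ++ p3).
  by rewrite -exprD size_cat !size_rcons; congr (_ ^+ _); lia.
have := walk_weight_cat c x (rcons p1 y) p3; rewrite last_rcons => <-.
rewrite mulrCA; apply: ler_pM; rewrite ?walk_weight_ge0 //.
  by rewrite closed_le ?last_rcons.
by apply: IHk; rewrite size_cat size_rcons; lia.
Qed.

(** * Limits of roots *)

Lemma cvg_powR_inv (R : realType) (K : R) : 0 < K ->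
  K `^ k%:R^-1 @[k --> \oo] --> (1 : R).
Proof.
move=> K_gt0; rewrite -cvg_shiftS.
(* The shift leaves out the index 0 and gives exactly the exponents 1 / (k + 1) of [harmonic]. *)
have -> : (fun k => K `^ k.+1%:R^-1) =
          (fun k => expR (ln K * @harmonic R k)).
  by apply/funext => k; rewrite /powR gt_eqF // mulrC.
rewrite -expR0 -[X in expR X](mulr0 (ln K)).
apply: continuous_cvg; first exact: continuous_expR.
by apply: cvgMr; exact: cvg_harmonic.
Qed.

Lemma cvg_root_sandwich (R : realType) (a : R^nat) (r : R)
    (a_ub : forall s, r < s -> exists2 K, 0 < K &
      forall k, (0 < k)%N -> a k <= K `^ k%:R^-1 * s)
    (a_lb : exists2 K, 0 < K & forall k, (0 < k)%N -> K `^ k%:R^-1 * r <= a k) :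
  a @ \oo --> r.
Proof.
apply/cvgrPdist_le => e e_gt0.
(* Half of [e] is kept in reserve: [K1] depends on [s], but its roots tend to 1, so the upper bounds
   tend to [r + e / 2], strictly below [r + e]. *)
have ltr_s : r < r + e / 2 by rewrite ltrDl divr_gt0.
have [K1 K1_gt0 ub] := a_ub _ ltr_s.
have [K2 K2_gt0 lb] := a_lb.
have cvg1 : K1 `^ k%:R^-1 * (r + e / 2) @[k --> \oo] --> r + e / 2.
  by rewrite -[X in _ --> X]mul1r; apply: cvgMl; exact: cvg_powR_inv.
have cvg2 : K2 `^ k%:R^-1 * r @[k --> \oo] --> r.
  by rewrite -[X in _ --> X]mul1r; apply: cvgMl; exact: cvg_powR_inv.
near=> k; have k_gt0 : (0 < k)%N by near: k; exact: nbhs_infty_gt.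
rewrite ler_distlC; apply/andP; split.
  apply: le_trans (lb _ k_gt0); near: k; apply: (cvgr_ge r cvg2).
  by rewrite ltrBlDr ltrDl.
apply: le_trans (ub _ k_gt0) _; near: k; apply: (cvgr_le _ cvg1).
by rewrite ltrD2l gtr_pMr // invf_lt1 ?ltr1n.
Unshelve. all: by end_near. Qed.

Lemma powR_expn_inv (R : realType) (x : R) (k : nat) : 0 <= x -> (0 < k)%N ->
  (x ^+ k) `^ k%:R^-1 = x.
Proof.
move=> x_ge0 k_gt0; rewrite -powR_mulrn // -powRrM mulfV ?pnatr_eq0 -?lt0n //.
by rewrite powRr1.
Qed.

Lemma powR_inv_expn (R : realType) (x : R) (k : nat) : 0 <= x -> (0 < k)%N ->
  (x `^ k%:R^-1) ^+ k = x.
Proof.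
move=> x_ge0 k_gt0; rewrite -powR_mulrn ?powR_ge0 // -powRrM mulVf.
  by rewrite powRr1.
by rewrite pnatr_eq0 -lt0n.
Qed.

(** All tail suprema of positive index equal [r], so their limit does too; the term of index 0
    escapes the upper bound. *)
Lemma limn_esup_eventually_max (R : realType) (a : (\bar R)^nat) (r : \bar R)
    (a_ub : forall k, (0 < k)%N -> (a k <= r)%E)
    (a_lb : forall k, exists2 j, (k <= j)%N & (r <= a j)%E) :
  limn_esup a = r.
Proof.
rewrite limn_esup_lim; apply: cvg_lim => //.
apply: cvg_near_cst; near=> k; apply/eqP; rewrite eq_le; apply/andP; split.
  apply: ge_ereal_sup => _ [j /= kj <-]; apply: a_ub.
  by apply: leq_trans kj; near: k; exact: nbhs_infty_gt.
have [j kj rj] := a_lb k.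
by apply: le_trans rj _; apply: ereal_sup_ubound; exists j.
Unshelve. all: by end_near. Qed.

(** * Rank-one matrices and submultiplicative norms *)

Lemma rank1_outer_prod (K : fieldType) (n : nat) (A : 'M[K]_n) :
  \rank A = 1%N ->
  exists uv : 'cV[K]_n * 'rV[K]_n, A = uv.1 *m uv.2 /\ uv.2 != 0.
Proof.
move=> rkA; have := mulmx_base A.
move: (col_base A) (row_base A) (row_base_free A); rewrite rkA => u v v_free uv.
by exists (u, v); split=> //=; rewrite -mxrank_eq0 (eqP v_free).
Qed.

Lemma normc_ge0 (R : rcfType) (z : R[i]) : 0 <= Normc.normc z.
Proof. by case: z => a b; exact: sqrtr_ge0. Qed.

Lemma normcX (R : rcfType) (z : R[i]) (k : nat) :
  Normc.normc (z ^+ k) = Normc.normc z ^+ k.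
Proof.
elim: k => [|k IHk]; first exact: Normc.normc1.
by rewrite !exprS Normc.normcM IHk.
Qed.

Lemma normc_walk_weight (R : rcfType) (T : Type) (d : T -> T -> R[i])
    (x : T) (p : seq T) :
  Normc.normc (walk_weight d x p) =
  walk_weight (fun y z => Normc.normc (d y z)) x p.
Proof.
elim: p x => [|y p IHp] x; first by rewrite !walk_weight_nil Normc.normc1.
by rewrite !walk_weight_cons Normc.normcM IHp.
Qed.

(** Eigenvectors are rows here, and [v] itself is one since v (u v) = (v u) v. *)
Lemma eigenvalue_outer_prod (K : fieldType) (n : nat) (u : 'cV[K]_n)
    (v : 'rV[K]_n) :
  v != 0 -> eigenvalue (u *m v) ((v *m u) 0 0).
Proof.
move=> v_neq0; apply/eigenvalueP; exists v => //.
by rewrite mulmxA [v *m u]mx11_scalar mul_scalar_mx -mx11_scalar.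
Qed.

Lemma spectral_radius_outer_prod (R : realType) (n : nat) (u : 'cV[R[i]]_n)
    (v : 'rV[R[i]]_n) :
  v != 0 -> spectral_radius (u *m v) = Normc.normc ((v *m u) 0 0).
Proof.
move=> v_neq0; set a := (v *m u) 0 0.
have eig_a : eigenvalue (u *m v) a by exact: eigenvalue_outer_prod.
have ub : ubound [set Normc.normc b | b in
    [set b : R[i] | eigenvalue (u *m v) b]] (Normc.normc a).
  move=> _ [b /= /eigenvalueP[x xuv x_neq0] <-].
  have [->|b_neq0] := eqVneq b 0; first by rewrite Normc.normc0 normc_ge0.
  suff -> : a = b by [].
  move: xuv; rewrite mulmxA [x *m u]mx11_scalar mul_scalar_mx.
  set t := (x *m u) 0 0 => tv.
  (* Multiplying t v = b x by [u] on the right gives t a = b t, and [t] is nonzero because b x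
     is. *)
  have := congr1 (fun y : 'rV_n => (y *m u) 0 0) tv.
  rewrite -!scalemxAl [LHS]mxE [RHS]mxE -/t -/a => ta.
  have t_neq0 : t != 0.
    apply: contraNneq x_neq0 => t0; move/eqP: tv.
    by rewrite t0 scale0r eq_sym scaler_eq0 (negPf b_neq0).
  by apply: (mulfI t_neq0); rewrite ta mulrC.
apply/eqP; rewrite eq_le; apply/andP; split.
  by apply: ge_sup => //; exists (Normc.normc a), a.
by apply: ub_le_sup; [exists (Normc.normc a) | exists a].
Qed.

(** * Products along words *)

Lemma word_prod_cat (R : realType) (m n : nat) (F : 'I_m -> 'M[R[i]]_n)
    (s t : seq 'I_m) :
  word_prod F (s ++ t) = word_prod F s *m word_prod F t.
Proof.
rewrite /word_prod; elim: s => [|i s IHs]; first by rewrite big_nil mul1mx.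
by rewrite /= !big_cons IHs mulmxA.
Qed.

Lemma word_prod_seq1 (R : realType) (m n : nat) (F : 'I_m -> 'M[R[i]]_n)
    (i : 'I_m) :
  word_prod F [:: i] = F i.
Proof. by rewrite /word_prod big_cons big_nil mulmx1. Qed.

(** Each inner product v_j u_k between consecutive letters is a scalar and can be pulled out. *)
Lemma word_prod_outer_prod (R : realType) (m n : nat) (F : 'I_m -> 'M[R[i]]_n)
    (u : 'I_m -> 'cV[R[i]]_n) (v : 'I_m -> 'rV[R[i]]_n)
    (F_uv : forall i, F i = u i *m v i) (i : 'I_m) (p : seq 'I_m) :
  word_prod F (i :: p) =
  walk_weight (fun j k => (v j *m u k) 0 0) i p *: (u i *m v (last i p)).
Proof.
elim: p i => [|j p IHp] i.
  by rewrite walk_weight_nil scale1r word_prod_seq1 F_uv.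
rewrite -cat1s word_prod_cat IHp word_prod_seq1 F_uv walk_weight_cons /=.
rewrite -scalemxAr mulmxA -[u i *m v i *m u j]mulmxA [v i *m u j]mx11_scalar.
by rewrite mul_mx_scalar -scalemxAl scalerA -mx11_scalar mulrC.
Qed.

(** The scalar goes into the column; the spectral radius of the outer product then supplies the
    factor of the step from the last letter back to [i]. *)
Lemma spectral_radius_word_prod (R : realType) (m n : nat)
    (F : 'I_m -> 'M[R[i]]_n)
    (u : 'I_m -> 'cV[R[i]]_n) (v : 'I_m -> 'rV[R[i]]_n)
    (F_uv : forall i, F i = u i *m v i) (v_neq0 : forall i, v i != 0)
    (i : 'I_m) (p : seq 'I_m) :
  spectral_radius (word_prod F (i :: p)) =
  walk_weight (fun j k => Normc.normc ((v j *m u k) 0 0)) i (rcons p i).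
Proof.
rewrite (word_prod_outer_prod F_uv) scalemxAl spectral_radius_outer_prod //.
rewrite -scalemxAr mxE Normc.normcM normc_walk_weight -cats1 walk_weight_cat.
by rewrite walk_weight_cons walk_weight_nil mulr1.
Qed.

Lemma word_prod_periodic_eigenvalue (R : realType) (m n : nat)
    (F : 'I_m -> 'M[R[i]]_n) (w : seq 'I_m) (a : R[i]) (q : nat) :
  eigenvalue (word_prod F w) a ->
  eigenvalue (word_prod F (flatten (nseq q w))) (a ^+ q).
Proof.
move=> /eigenvalueP[x xw x_neq0]; apply/eigenvalueP; exists x => //.
elim: q => [|q IHq]; first by rewrite /word_prod big_nil mulmx1 scale1r.
by rewrite /= word_prod_cat mulmxA xw -scalemxAl IHq scalerA exprS.
Qed.

(** * Norms and eigenvalues *)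

Lemma submult_norm_ge0 (R : realType) (n : nat) (N : 'M[R[i]]_n -> R)
    (N_norm : submultiplicative_norm N) (A : 'M[R[i]]_n) : 0 <= N A.
Proof.
have N0 : N 0 = 0.
  by rewrite -(scale0r 0) (submult_normZ N_norm) Normc.normc0 mul0r.
have NN : N (- A) = N A.
  rewrite -scaleN1r (submult_normZ N_norm) (normcN (1 : R[i])).
  by rewrite Normc.normc1 mul1r.
(* The triangle inequality for [A] and [- A] reads 0 <= 2 N A. *)
by have := submult_normD N_norm A (- A); rewrite subrr N0 NN -mulr2n pmulrn_lge0.
Qed.

Lemma eigenvalue_le_submult_norm (R : realType) (n : nat) (N : 'M[R[i]]_n -> R)
    (N_norm : submultiplicative_norm N) (A : 'M[R[i]]_n) (a : R[i]) :
  eigenvalue A a -> Normc.normc a <= N A.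
Proof.
move=> /eigenvalueP[x xA x_neq0].
have /rV0Pn[j xj] := x_neq0.
(* Stacking copies of the row eigenvector makes a square matrix, to which [N] applies; V A = a V
   gives the bound after division by N V. *)
pose V : 'M[R[i]]_n := \matrix_(i < n) x.
have VA : V *m A = a *: V.
  by apply/row_matrixP => i; rewrite row_mul linearZ /= rowK.
have V_gt0 : 0 < N V.
  rewrite lt_neqAle submult_norm_ge0 // andbT eq_sym; apply/eqP.
  by move/(submult_norm_eq0 N_norm)/matrixP/(_ j j)/eqP; rewrite !mxE (negPf xj).
rewrite -(ler_pM2l V_gt0) mulrC -(submult_normZ N_norm) -VA.
exact: submult_normM.
Qed.

(** The norm bounds the set of moduli, so that its [sup] is a genuine upper bound. *)
Lemma eigenvalue_le_spectral_radius (R : realType) (n : nat)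
    (N : 'M[R[i]]_n -> R) (N_norm : submultiplicative_norm N)
    (A : 'M[R[i]]_n) (a : R[i]) :
  eigenvalue A a -> Normc.normc a <= spectral_radius A.
Proof.
move=> eig_a; apply: ub_le_sup; last by exists a.
by exists (N A) => _ [b /= eig_b <-]; exact: eigenvalue_le_submult_norm.
Qed.

Lemma submult_norm_word_prod_le (R : realType) (m n : nat)
    (N : 'M[R[i]]_n -> R) (F : 'I_m -> 'M[R[i]]_n)
    (N_norm : submultiplicative_norm N) (b : R) (F_le : forall i, N (F i) <= b)
    (w : seq 'I_m) :
  N (word_prod F w) <= N 1%:M * b ^+ size w.
Proof.
elim: w => [|i w IHw]; first by rewrite /word_prod big_nil mulr1.
rewrite -cat1s word_prod_cat word_prod_seq1 /= exprS mulrCA.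
apply: le_trans (submult_normM N_norm _ _) _.
by apply: ler_pM; rewrite ?submult_norm_ge0.
Qed.

(** * Maxima over words of a fixed length *)

Lemma le_max_norm_root (R : realType) (m n : nat) (N : 'M[R[i]]_n -> R)
    (F : 'I_m -> 'M[R[i]]_n) (w : seq 'I_m) :
  N (word_prod F w) `^ (size w)%:R^-1 <= max_norm_root N F (size w).
Proof.
exact: (le_bigmax 0 (fun t : _.-tuple _ => N (word_prod F t) `^ _) (in_tuple w)).
Qed.

Lemma le_max_spectral_root (R : realType) (m n : nat) (F : 'I_m -> 'M[R[i]]_n)
    (w : seq 'I_m) :
  spectral_radius (word_prod F w) `^ (size w)%:R^-1 <=
  max_spectral_root F (size w).
Proof.
exact: (le_bigmax 0 (fun t : _.-tuple _ =>
  spectral_radius (word_prod F t) `^ _) (in_tuple w)).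
Qed.

Lemma le_max_distinct_spectral_root (R : realType) (m n : nat)
    (F : 'I_m -> 'M[R[i]]_n) (w : seq 'I_m) :
  uniq w ->
  spectral_radius (word_prod F w) `^ (size w)%:R^-1 <=
  max_distinct_spectral_root F (size w).
Proof.
exact: (@le_bigmax_cond _ _ _ 0 (in_tuple w) _ (fun t : _.-tuple _ =>
  spectral_radius (word_prod F t) `^ _)).
Qed.

Definition max_cycle_root (R : realType) (m n : nat)
    (F : 'I_m -> 'M[R[i]]_n) : R :=
  \big[Num.max/0]_(1 <= k < m.+1) max_distinct_spectral_root F k.

Lemma max_cycle_root_ge0 (R : realType) (m n : nat) (F : 'I_m -> 'M[R[i]]_n) :
  0 <= max_cycle_root F.
Proof. exact: bigmax_ge_id. Qed.

Lemma max_cycle_root_attained (R : realType) (m n : nat)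
    (F : 'I_m -> 'M[R[i]]_n) :
  0 < max_cycle_root F -> exists i p,
    max_cycle_root F =
    spectral_radius (word_prod F (i :: p)) `^ (size p).+1%:R^-1.
Proof.
set r := max_cycle_root F => r_gt0.
(* This property is vacuous at the default value 0 and stable under maximum, so it passes to the
   iterated maxima. *)
pose attained x := 0 < x -> exists i p,
  x = spectral_radius (word_prod F (i :: p)) `^ (size p).+1%:R^-1.
have attained_max x y : attained x -> attained y -> attained (Num.max x y).
  by rewrite /Num.max; case: ifP.
suff : attained r by apply.
rewrite /r /max_cycle_root big_nat_cond; apply: big_ind => //.
  by rewrite /attained ltxx.
move=> k /andP[/andP[k_gt0 _] _]; apply: big_ind => //.
  by rewrite /attained ltxx.
case=> -[|i p] /= /eqP sz_w _ _; first by rewrite -sz_w in k_gt0.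
by exists i, p; rewrite sz_w.
Qed.

(** * Spectral radii of a rank-one family *)

Section RankOneFamily.
Variables (R : realType) (m n : nat) (F : 'I_m -> 'M[R[i]]_n).
Variables (N : 'M[R[i]]_n -> R) (N_norm : submultiplicative_norm N).
Variables (u : 'I_m -> 'cV[R[i]]_n) (v : 'I_m -> 'rV[R[i]]_n).
Hypotheses (F_uv : forall i, F i = u i *m v i) (v_neq0 : forall i, v i != 0).

Let c j k := Normc.normc ((v j *m u k) 0 0).
Let r := max_cycle_root F.

Let c_ge0 j k : 0 <= c j k. Proof. exact: normc_ge0. Qed.
Let r_ge0 : 0 <= r. Proof. exact: max_cycle_root_ge0. Qed.

Lemma cycle_weight_le i p :
  uniq (i :: p) -> walk_weight c i (rcons p i) <= r ^+ (size p).+1.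
Proof.
move=> uip; rewrite -(spectral_radius_word_prod F_uv v_neq0).
set x := spectral_radius _.
have x_ge0 : 0 <= x.
  by rewrite /x (spectral_radius_word_prod F_uv v_neq0) walk_weight_ge0.
rewrite -(@powR_inv_expn _ x (size p).+1) // lerXn2r ?nnegrE ?powR_ge0 //.
apply: le_trans (le_max_distinct_spectral_root F uip) _.
apply: (@le_bigmax_seq _ _ _ _ 0 (size p).+1 xpredT) => //.
(* Distinct letters number at most [m], so the length is in the range of the maximum. *)
have := max_card (mem (i :: p)).
by rewrite (card_uniqP uip) card_ord mem_index_iota ltnS.
Qed.

Lemma closed_weight_le i p :
  last i p = i -> walk_weight c i p <= r ^+ size p.
Proof. exact: (closed_walk_weight_le c_ge0 r_ge0 cycle_weight_le). Qed.

(** An eigenvalue, rather than a spectral radius, is exhibited because its powers are eigenvalues of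
    the products along repetitions of [w]. *)
Lemma max_cycle_root_eigenvalue : 0 < r -> exists w a,
  [/\ (0 < size w)%N, eigenvalue (word_prod F w) a & Normc.normc a = r ^+ size w].
Proof.
move=> /max_cycle_root_attained[i [p r_eq]].
have W_eq := word_prod_outer_prod F_uv i p; rewrite scalemxAl in W_eq.
set x := walk_weight _ _ _ *: u i in W_eq.
exists (i :: p), ((v (last i p) *m x) 0 0).
split=> //; first by rewrite W_eq eigenvalue_outer_prod.
rewrite -spectral_radius_outer_prod // -W_eq /r r_eq powR_inv_expn //.
by rewrite (spectral_radius_word_prod F_uv v_neq0) walk_weight_ge0.
Qed.

(** * The generalized spectral radius *)

Lemma max_spectral_root_le k : (0 < k)%N -> max_spectral_root F k <= r.
Proof.
move=> k_gt0; apply: bigmax_le => // -[[|i p] /= /eqP sz_w] _.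
  by rewrite -sz_w in k_gt0.
rewrite -[leRHS](@powR_expn_inv _ _ k) //.
rewrite (spectral_radius_word_prod F_uv v_neq0).
apply: ge0_ler_powR; rewrite ?invr_ge0 ?nnegrE ?exprn_ge0 ?walk_weight_ge0 //.
(* The return to [i] adds one step, so a word of [k] letters is a closed walk of exactly [k]
   steps. *)
by rewrite -sz_w -(size_rcons p i) closed_weight_le // last_rcons.
Qed.

Lemma max_spectral_root_ge k : exists2 j, (k <= j)%N & r <= max_spectral_root F j.
Proof.
have [r0|r_neq0] := eqVneq r 0; first by exists k; rewrite // r0 bigmax_ge_id.
have r_gt0 : 0 < r by rewrite lt_neqAle eq_sym r_neq0.
have [w [a [w_gt0 eig_a norm_a]]] := max_cycle_root_eigenvalue r_gt0.
(* Repetition gives arbitrarily long words with the same root: the product along [t] has an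
   eigenvalue of modulus r ^ |t|. *)
pose t := flatten (nseq k.+1 w).
have sz_t : size t = (size w * k.+1)%N.
  by rewrite size_flatten /shape map_nseq sumn_nseq.
have t_gt0 : (0 < size t)%N by rewrite sz_t muln_gt0 w_gt0.
exists (size t).
  by rewrite sz_t; apply: leq_trans (leqnSn k) _; rewrite leq_pmull.
apply: le_trans (le_max_spectral_root F t).
rewrite -[leLHS](@powR_expn_inv _ _ (size t)) // sz_t exprM -norm_a -normcX.
have le_sr := eigenvalue_le_spectral_radius N_norm
  (word_prod_periodic_eigenvalue k.+1 eig_a).
apply: ge0_ler_powR; rewrite ?invr_ge0 ?nnegrE ?normc_ge0 //.
exact: le_trans (normc_ge0 _) le_sr.
Qed.

Lemma generalized_spectral_radiusE : generalized_spectral_radius F = r%:E.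
Proof.
apply: limn_esup_eventually_max => k.
  by rewrite lee_fin; exact: max_spectral_root_le.
by have [j kj rj] := max_spectral_root_ge k; exists j; rewrite ?lee_fin.
Qed.

(** * The joint spectral radius *)

Lemma max_norm_root_le s : r < s -> exists2 K, 0 < K &
  forall k, (0 < k)%N -> max_norm_root N F k <= K `^ k%:R^-1 * s.
Proof.
move=> r_lt_s; have s_gt0 : 0 < s by exact: le_lt_trans r_lt_s.
(* [C] makes every step weight at most [C * s]; this takes [s > 0], as [r] may vanish while step
   weights do not. [B] bounds the norms of all the outer products. *)
pose C := 1 + (\sum_i \sum_j c i j) / s.
pose B := 1 + \sum_i \sum_j N (u i *m v j).
have le_sum2 (f : 'I_m -> 'I_m -> R) i j :
    (forall i j, 0 <= f i j) -> f i j <= \sum_i \sum_j f i j.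
  move=> f_ge0; rewrite (bigD1 i) //= (bigD1 j) //= -addrA lerDl.
  by rewrite addr_ge0 // !sumr_ge0 // => *; rewrite sumr_ge0.
have C_ge1 : 1 <= C.
  rewrite lerDl divr_ge0 ?(ltW s_gt0) // sumr_ge0 // => i _.
  by rewrite sumr_ge0.
have B_ge1 : 1 <= B.
  rewrite lerDl sumr_ge0 // => i _; rewrite sumr_ge0 // => j _.
  exact: submult_norm_ge0.
have c_le i j : c i j <= C * s.
  rewrite mulrDl mul1r divfK ?gt_eqF //.
  by apply: le_trans (le_sum2 c i j c_ge0) _; rewrite lerDr ltW.
have uv_le i j : N (u i *m v j) <= B.
  apply: le_trans (le_sum2 (fun i j => N (u i *m v j)) i j _) _.
    by move=> *; exact: submult_norm_ge0.
  by rewrite lerDr.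
have closed_le i p : last i p = i -> walk_weight c i p <= s ^+ size p.
  move=> /closed_weight_le/le_trans; apply.
  by rewrite lerXn2r ?nnegrE ?(ltW s_gt0) ?(ltW r_lt_s).
(* The division by [s] is there because a word of [k] letters has only k - 1 steps between
   letters. *)
have K_gt0 : 0 < C ^+ m * B / s.
  by rewrite divr_gt0 // mulr_gt0 ?exprn_gt0 // ?(lt_le_trans ltr01).
exists (C ^+ m * B / s) => // k k_gt0; set K := C ^+ m * B / s in K_gt0 *.
have [s_ge0 K_ge0] := (ltW s_gt0, ltW K_gt0).
apply: bigmax_le => [|[[|i p] /= /eqP sz_w] _].
- by rewrite mulr_ge0 ?powR_ge0.
- by rewrite -sz_w in k_gt0.
have Ks_ge0 : 0 <= K * s ^+ k by rewrite mulr_ge0 ?exprn_ge0.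
rewrite -[X in _ * X](@powR_expn_inv _ _ k) // -powRM ?exprn_ge0 //.
apply: ge0_ler_powR; rewrite ?invr_ge0 ?nnegrE ?submult_norm_ge0 //.
rewrite (word_prod_outer_prod F_uv) (submult_normZ N_norm) normc_walk_weight.
rewrite -sz_w exprS mulrA /K divfK ?gt_eqF // mulrAC.
apply: ler_pM; rewrite ?walk_weight_ge0 ?submult_norm_ge0 //.
have := open_walk_weight_le c_ge0 (ltW s_gt0) C_ge1 c_le closed_le i p.
by rewrite card_ord.
Qed.

(** For r > 0, a prefix of length [k] of the periodic word is completed to a whole number of periods
    [t] by at most [size w] letters. Then r ^ |t| <= N(prefix) N(rest), and N(rest) is bounded by a
    constant. *)
Lemma max_norm_root_ge : exists2 K, 0 < K &
  forall k, (0 < k)%N -> K `^ k%:R^-1 * r <= max_norm_root N F k.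
Proof.
have [r0|r_neq0] := eqVneq r 0.
  by exists 1 => // k _; rewrite r0 mulr0 bigmax_ge_id.
have r_gt0 : 0 < r by rewrite lt_neqAle eq_sym r_neq0.
have [w [a [w_gt0 eig_a norm_a]]] := max_cycle_root_eigenvalue r_gt0.
pose b := 1 + \sum_i N (F i).
have b_ge1 : 1 <= b.
  by rewrite lerDl sumr_ge0 // => i _; exact: submult_norm_ge0.
have F_le i : N (F i) <= b.
  rewrite /b (bigD1 i) //= addrCA lerDl addr_ge0 // sumr_ge0 // => j _.
  exact: submult_norm_ge0.
(* [B] bounds the norm along any word of at most [size w] letters; the added 1 makes it a positive
   divisor. *)
pose B := (1 + N 1%:M) * b ^+ size w.
have B_gt0 : 0 < B.
  rewrite mulr_gt0 ?exprn_gt0 ?(lt_le_trans ltr01) //.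
  by rewrite lerDl submult_norm_ge0.
(* Whether [r] is below or above 1, r ^ |rest| is at least r1 ^ |rest|, hence at least r1 ^ |w|. *)
pose r1 := Num.min 1 r.
have r1_gt0 : 0 < r1 by rewrite lt_min ltr01.
have K_gt0 : 0 < r1 ^+ size w / B by rewrite divr_gt0 ?exprn_gt0.
exists (r1 ^+ size w / B) => // k k_gt0; set K := r1 ^+ size w / B in K_gt0 *.
have K_ge0 := ltW K_gt0.
(* One period more than the quotient, so that [t] is longer than [k]. *)
pose q := (k %/ size w).+1; pose t := flatten (nseq q w).
have sz_t : size t = (size w * q)%N.
  by rewrite size_flatten /shape map_nseq sumn_nseq.
have sz_drop : (size (drop k t) <= size w)%N.
  rewrite size_drop sz_t /q; have := divn_eq k (size w); nia.
have k_le : (k <= size t)%N by rewrite sz_t mulnC ltnW // ltn_ceil.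
have sz_take : size (take k t) = k by rewrite size_takel.
have := le_max_norm_root N F (take k t); rewrite sz_take; apply: le_trans.
have Kr_ge0 : 0 <= K * r ^+ k by rewrite mulr_ge0 ?exprn_ge0.
rewrite -[X in _ * X](@powR_expn_inv _ _ k) // -powRM ?exprn_ge0 //.
apply: ge0_ler_powR; rewrite ?invr_ge0 ?nnegrE ?submult_norm_ge0 //.
have eig_t := word_prod_periodic_eigenvalue q eig_a.
have := eigenvalue_le_submult_norm N_norm eig_t; rewrite -/t.
rewrite normcX norm_a -exprM -sz_t -{2}(cat_take_drop k t) word_prod_cat.
move=> /le_trans/(_ (submult_normM N_norm _ _)) t_le.
rewrite /K mulrAC ler_pdivrMr //.
have drop_le : N (word_prod F (drop k t)) <= B.
  apply: le_trans (submult_norm_word_prod_le N_norm F_le _) _.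
  have b_ge0 : 0 <= b by exact: le_trans b_ge1.
  apply: ler_pM; rewrite ?submult_norm_ge0 ?lerDr ?exprn_ge0 //.
  exact: ler_weXn2l.
apply: le_trans (le_trans t_le (ler_wpM2l (submult_norm_ge0 N_norm _) drop_le)).
rewrite -(cat_take_drop k t) size_cat sz_take exprD mulrC.
rewrite ler_wpM2l ?exprn_ge0 //.
apply: (@le_trans _ _ (r1 ^+ size (drop k t))).
  by rewrite ler_wiXn2l ?(ltW r1_gt0) // ge_min lexx.
by rewrite lerXn2r ?nnegrE ?(ltW r1_gt0) // ge_min lexx orbT.
Qed.

Lemma max_norm_root_cvg : max_norm_root N F @ \oo --> r.
Proof. exact: cvg_root_sandwich max_norm_root_le max_norm_root_ge. Qed.

End RankOneFamily.

Theorem mainTheorem2 (R : realType) (m n : nat) (F : 'I_m -> 'M[R[i]]_n)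
    (N : 'M[R[i]]_n -> R)
    (m_gt0 : (0 < m)%N)
    (F_rank1 : forall i : 'I_m, \rank (F i) = 1%N)
    (N_norm : submultiplicative_norm N) :
  let r := \big[Num.max/0]_(1 <= k < m.+1) max_distinct_spectral_root F k in
  [/\ cvgn (max_norm_root N F),
      joint_spectral_radius N F = r
    & generalized_spectral_radius F = r%:E].
Proof.
have [uv F_uv] := choice (fun i => rank1_outer_prod (F_rank1 i)).
have FE i : F i = (uv i).1 *m (uv i).2 by have [] := F_uv i.
have v_neq0 i : (uv i).2 != 0 by have [] := F_uv i.
have cvgN := max_norm_root_cvg N_norm FE v_neq0.
split.
(* Convergence is established on its own, since [limn] also has a value on divergent sequences. *)
- by apply/cvg_ex; exists (max_cycle_root F).
- exact: cvg_lim cvgN.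
- exact: (generalized_spectral_radiusE N_norm FE v_neq0).
Qed.
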